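(* Let $T=(T_1,\ldots,T_n)\in B(H)^n$ be a commuting tuple of degree $\gamma$ with respect to the orthogonal decomposition $H=\bigoplus_{k\ge 0}H_k$ (Hilbert space direct sum). Then the following conditions are equivalent: (i) there is a finite set $\{x_1,\ldots,x_\ell\}\subset H$ with $H=[\{x_1,\ldots,x_\ell\}]$; (ii) $\dim W_T(H)<\infty$; (iii) the $\mathbb C[z]$-module $\tilde H$ is finitely generated. In this case, $N=\dim W_T(H)$ is the minimal number of generators of the $\mathbb C[z]$-module $\tilde H$, the tuple $T$ is $N$-cyclic, and each basis of the vector space $W_T(H)$ generates $\tilde H$ as a $\mathbb C[z]$-module (in particular $W_T(H)\subset\tilde H$).
   Context: $\mathbb N=\{0,1,2,\ldots\}$, $\mathbb C[z]=\mathbb C[z_1,\ldots,z_n]$. $H$ is a complex Hilbert space with a fixed orthogonal decomposition into closed subspaces $H_k$ ($k\in\mathbb N$), i.e. $H$ is the Hilbert space orthogonal direct sum of the $H_k$. Let $\gamma=(\gamma_1,\ldots,\gamma_n)$ be a tuple of integers $\gamma_i>0$. A commuting tuple $T=(T_1,\ldots,T_n)\in B(H)^n$ of bounded operators is of degree $\gamma$ (or $\gamma$-graded) if $T_iH_k\subset H_{k+\gamma_i}$ for all $k\in\mathbb N$, $i=1,\ldots,n$. For a subset $A\subset H$, $[A]$ denotes the closed linear span of $\bigcup_{k\in\mathbb N^n}T^kA$ (the smallest closed $T$-invariant subspace containing $A$). $W_T(H)=H\ominus\sum_{i=1}^nT_iH$ is the orthogonal complement of $\sum_{i=1}^n T_iH$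 in $H$. $\tilde H=\bigoplus_{k\ge0}H_k$ is the algebraic direct sum (finite sums of elements of the $H_k$), a $\mathbb C[z]$-module via $(p,x)\mapsto p(T)x$. $T$ is called $N$-cyclic if there is a tuple $(x_1,\ldots,x_N)\in H^N$ such that $H$ is the closed linear span of $\{p(T)x_i:\ p\in\mathbb C[z],\ i=1,\ldots,N\}$ and $N$ is the minimal natural number with this property (for $N=0$ this means $H=\{0\}$). *)

(* Defs.v *)
From HB Require Import structures.
From mathcomp Require Import all_boot all_order all_algebra.
From mathcomp Require Import all_classical all_reals all_analysis.
From mathcomp Require Import complex.
(* Without the notations of mpoly, which clash with those of all_analysis. *)
From mathcomp Require Import -(notations) mpoly.

Set Implicit Arguments.
Unset Strict Implicit.
Unset Printing Implicit Defensive.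

Import Order.TTheory GRing.Theory Num.Theory.
Import numFieldNormedType.Exports.

Local Open Scope classical_set_scope.
Local Open Scope ring_scope.

Section LinearAlgebra.
Variables (K : fieldType) (V : lmodType K).

Definition subspace (A : set V) : Prop :=
  A 0 /\ forall (a : K) (x y : V), A x -> A y -> A (a *: x + y).

Definition lspan (A : set V) : set V :=
  [set x | exists m (c : 'I_m -> K) (v : 'I_m -> V),
     (forall i, A (v i)) /\ x = \sum_(i < m) c i *: v i].

Definition lin_indep N (b : 'I_N -> V) : Prop :=
  forall c : 'I_N -> K, \sum_(i < N) c i *: b i = 0 -> forall i, c i = 0.

Definition is_basis (W : set V) N (b : 'I_N -> V) : Prop :=
  lin_indep b /\ lspan (range b) = W.

Definition has_dim (W : set V) (N : nat) : Prop :=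
  exists b : 'I_N -> V, is_basis W b.

Definition finite_dim (W : set V) : Prop := exists N, has_dim W N.

End LinearAlgebra.

Section PolynomialAction.
Variables (K : fieldType) (V : lmodType K) (n : nat) (T : 'I_n -> {linear V -> V}).

Definition commuting_tuple : Prop := forall i j x, T i (T j x) = T j (T i x).

(* T^k = T_0^(k_0) o ... o T_(n-1)^(k_(n-1)) *)
Definition tuple_pow (k : 'I_n -> nat) : V -> V :=
  \big[(fun f g : V -> V => f \o g)/id]_(i < n) iter (k i) (T i).

(* p(T) x; the polynomials p of K[z_1, ..., z_n] form the type mpoly n K *)
Definition poly_act (p : mpoly n K) (x : V) : V :=
  \sum_(m <- msupp p) mcoeff m p *: tuple_pow m x.

(* M is meant to be stable under the action of K[z]: it is then a K[z]-module
   and the g i are generators of this module. *)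
Definition generates_module (M : set V) N (g : 'I_N -> V) : Prop :=
  (forall i, M (g i)) /\
  forall x, M x -> exists p : 'I_N -> mpoly n K, x = \sum_(i < N) poly_act (p i) (g i).

Definition generated_by (M : set V) (N : nat) : Prop :=
  exists g : 'I_N -> V, generates_module M g.

Definition finitely_generated (M : set V) : Prop := exists N, generated_by M N.

Definition min_number_of_generators (M : set V) (N : nat) : Prop :=
  generated_by M N /\ forall N', generated_by M N' -> (N <= N')%N.

(* T_0 V + ... + T_(n-1) V *)
Definition sum_ranges : set V :=
  [set y | exists x : 'I_n -> V, y = \sum_(i < n) T i (x i)].

End PolynomialAction.

Section HilbertSpace.
Variables (R : realType) (H : completeNormedModType R[i]).

(* With an inner product satisfying this, H is a complex Hilbert space;
   the inner product is linear in its first argument. *)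
Definition induces_norm (dot : {dot H for Num.conj}) : Prop :=
  forall x, dot x x = `|x| ^+ 2.

Definition bounded_op (f : H -> H) : Prop :=
  exists M : R, forall x, `|f x| <= (M%:C)%C * `|x|.

Definition ortho_compl (dot : {dot H for Num.conj}) (A : set H) : set H :=
  [set x | forall y, A y -> dot x y = 0].

Definition alg_sum (Hk : nat -> set H) : set H :=
  [set x | exists m (v : nat -> H),
     (forall k, Hk k (v k)) /\ x = \sum_(0 <= k < m) v k].

Definition hilbert_direct_sum (dot : {dot H for Num.conj}) (Hk : nat -> set H) : Prop :=
  [/\ forall k, subspace (Hk k),
      forall k, closed (Hk k),
      forall j k x y, j <> k -> Hk j x -> Hk k y -> dot x y = 0
    & closure (alg_sum Hk) = [set: H]].

Variables (n : nat) (T : 'I_n -> {linear H -> H}).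

Definition of_degree (Hk : nat -> set H) (gamma : 'I_n -> nat) : Prop :=
  forall k i x, Hk k x -> Hk (k + gamma i)%N (T i x).

Definition invariant_hull (A : set H) : set H :=
  closure (lspan [set y | exists (k : 'I_n -> nat) x, A x /\ y = tuple_pow T k x]).

Definition wandering (dot : {dot H for Num.conj}) : set H :=
  ortho_compl dot (sum_ranges T).

Definition cyclic_vectors N (x : 'I_N -> H) : Prop :=
  closure (lspan [set y | exists (p : mpoly n R[i]) i, y = poly_act T p (x i)])
    = [set: H].

Definition is_cyclic (N : nat) : Prop :=
  (exists x : 'I_N -> H, cyclic_vectors x) /\
  forall N', (exists x : 'I_N' -> H, cyclic_vectors x) -> (N <= N')%N.

End HilbertSpace.

(* Main.v *)
(* A vector of W = W_T(H) orthogonal to a set A is orthogonal to all T^k A, so if A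
   generates a dense submodule, W contains no independent family longer than A.
   Conversely let dim W < oo. By induction on k, each H_k is finite dimensional:
   the span of the T_i H_(k - gamma_i) is finite dimensional, and its orthogonal
   complement in H_k lies in W. Hence the homogeneous vectors of W generate Htilde.
   A vector of W orthogonal to them is then orthogonal to the dense space Htilde,
   so W is spanned by its homogeneous vectors and W lies in Htilde. *)
Require Import Defs.
From HB Require Import structures.
From mathcomp Require Import all_boot all_order all_algebra.
From mathcomp Require Import all_classical all_reals all_analysis.
From mathcomp Require Import complex.
From mathcomp Require Import -(notations) mpoly.

Set Implicit Arguments.
Unset Strict Implicit.
Unset Printing Implicit Defensive.

Import Order.TTheory GRing.Theory Num.Theory.
Import numFieldNormedType.Exports.

Local Open Scope classical_set_scope.
Local Open Scope ring_scope.

(* [all_analysis] shadows this name with the subspace topology. *)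
Local Notation subspace := Defs.subspace.

(** * Linear spans, independent families and dimension *)

Section LinearSpan.
Variables (K : fieldType) (V : lmodType K).
Implicit Types A B : set V.

Lemma subspace0 A : subspace A -> A 0.
Proof. by case. Qed.

Lemma subspaceZ A : subspace A -> forall a x, A x -> A (a *: x).
Proof. by move=> [A0 AP] a x Ax; rewrite -[_ *: _]addr0; apply: AP. Qed.

Lemma subspaceD A : subspace A -> forall x y, A x -> A y -> A (x + y).
Proof. by move=> [A0 AP] x y Ax Ay; rewrite -[x]scale1r; apply: AP. Qed.

Lemma subspaceB A : subspace A -> forall x y, A x -> A y -> A (x - y).
Proof.
by move=> sA x y Ax Ay; rewrite -scaleN1r; apply: subspaceD => //; exact: subspaceZ.
Qed.

Lemma subspace_sum A : subspace A ->
  forall (I : Type) (r : seq I) (P : pred I) (F : I -> V),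
  (forall i, P i -> A (F i)) -> A (\sum_(i <- r | P i) F i).
Proof.
move=> sA I r P F AF; apply: (big_ind A) => //; first exact: subspace0.
by move=> x y; exact: subspaceD.
Qed.

Lemma subspaceI A B : subspace A -> subspace B -> subspace (A `&` B).
Proof. by move=> [A0 AP] [B0 BP]; split=> // a x y [? ?] [? ?]; split; auto. Qed.

Lemma subspace_preimage (U : lmodType K) (f : {linear V -> U}) (B : set U) :
  subspace B -> subspace (f @^-1` B).
Proof.
move=> [B0 BP]; split=> [|a x y Bx By]; rewrite /preimage/= ?linear0//.
by rewrite linearP; exact: BP.
Qed.

Lemma lspan_subspace A : subspace (lspan A).
Proof.
split; first by exists 0%N, (fun=> 0), (fun=> 0); split=> [[]//|]; rewrite big_ord0.
move=> a _ _ [m [c [v [Av ->]]]] [p [d [w [Aw ->]]]].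
exists (m + p)%N, (fun i => match fintype.split i with inl j => a * c j | inr j => d j end),
  (fun i => match fintype.split i with inl j => v j | inr j => w j end).
split; first by move=> i; case: fintype.split.
rewrite big_split_ord/= scaler_sumr; congr (_ + _); apply: eq_bigr => i _.
  by rewrite (unsplitK (inl i)) scalerA.
by rewrite (unsplitK (inr i)).
Qed.

Lemma sub_lspan A : A `<=` lspan A.
Proof.
by move=> x Ax; exists 1%N, (fun=> 1), (fun=> x); split=> //; rewrite big_ord1 scale1r.
Qed.

Lemma lspan_min A B : subspace B -> A `<=` B -> lspan A `<=` B.
Proof.
move=> sB AB _ [m [c [v [Av ->]]]]; apply: subspace_sum => // i _.
by apply: subspaceZ => //; exact: AB.
Qed.

Lemma lspan_mono A B : A `<=` B -> lspan A `<=` lspan B.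
Proof.
by move=> AB; apply: lspan_min (lspan_subspace _) _ => x /AB; exact: sub_lspan.
Qed.

Lemma lspan_rangeP N (b : 'I_N -> V) x :
  lspan (range b) x <-> exists c : 'I_N -> K, x = \sum_(i < N) c i *: b i.
Proof.
split; last by move=> [c ->]; exists N, c, b; split=> // i; exists i.
move: x; apply: (@lspan_min _ [set x | exists c : 'I_N -> K, x = \sum_(i < N) c i *: b i]).
  split; first by exists (fun=> 0); rewrite big1// => i _; rewrite scale0r.
  move=> a _ _ [c ->] [d ->]; exists (fun i => a * c i + d i).
  rewrite scaler_sumr -big_split; apply: eq_bigr => i _ /=.
  by rewrite scalerDl scalerA.
move=> _ [i _ <-]; exists (fun j => (j == i)%:R).
rewrite (bigD1 i)//= eqxx scale1r big1 ?addr0// => j /negPf ->.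
by rewrite scale0r.
Qed.

Lemma is_basis_mem A N (b : 'I_N -> V) : is_basis A b -> forall i, A (b i).
Proof. by move=> [_ <-] i; apply: sub_lspan; exists i. Qed.

Lemma wide_matrix_kernel M N (A : 'M[K]_(M, N)) :
  (N < M)%N -> exists2 u : 'rV_M, u != 0 & u *m A = 0.
Proof.
move=> NM; have : kermx A != 0.
  by rewrite kermx_eq0 -row_leq_rank -ltnNge (leq_ltn_trans (rank_leq_col A)).
by case/rowV0Pn => u /sub_kermxP uA u0; exists u.
Qed.

(** The coordinates of the [v i] along [b] form an M by N matrix; if N < M, a nonzero vector of its
    left kernel is a relation between the [v i]. *)
Lemma lin_indep_leq N (b : 'I_N -> V) M (v : 'I_M -> V) :
  lin_indep v -> (forall i, lspan (range b) (v i)) -> (M <= N)%N.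
Proof.
move=> vi vb; have [c vE] := choice (fun i => (lspan_rangeP b (v i)).1 (vb i)).
rewrite leqNgt; apply/negP => NM.
have [u /eqP u0 uc] := wide_matrix_kernel (\matrix_(i, j) c i j) NM.
apply: u0; apply/rowP => i; rewrite mxE; apply: (vi (fun i => u 0 i)) => {i}.
under eq_bigr => i _ do rewrite vE scaler_sumr.
rewrite exchange_big/= big1// => j _.
move/rowP/(_ j) : uc; rewrite !mxE => uc.
under eq_bigr => i _ do rewrite scalerA.
rewrite -scaler_suml (_ : \sum_(i < M) _ = 0) ?scale0r// -[RHS]uc.
by apply: eq_bigr => i _; rewrite mxE.
Qed.

(** A relation with nonzero coefficient at [ord0] could be solved for [x]. *)
Lemma lin_indep_extend M (v : 'I_M -> V) x :
  lin_indep v -> ~ lspan (range v) x ->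
  lin_indep (fun i : 'I_M.+1 => oapp v x (unlift ord0 i)).
Proof.
move=> vi xv c; rewrite big_ord_recl unlift_none/=.
under eq_bigr => i _ do rewrite liftK/=.
move=> cE; have c0 : c ord0 = 0.
  apply: contrapT => /eqP c0; apply: xv; apply/lspan_rangeP.
  exists (fun i => - (c ord0)^-1 * c (lift ord0 i)).
  under eq_bigr => i _ do rewrite -scalerA.
  rewrite -scaler_sumr scaleNr -scalerN.
  by move/eqP: cE; rewrite addr_eq0 => /eqP <-; rewrite scalerK.
move: cE; rewrite c0 scale0r add0r => /vi cv i.
by case: (unliftP ord0 i) => [j ->|->].
Qed.

(** An independent family that does not span can be extended, and the bound [N] stops this
    process. *)
Lemma finite_dim_bounded A N : subspace A ->
  (forall M (v : 'I_M -> V), lin_indep v -> (forall i, A (v i)) -> (M <= N)%N) ->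
  finite_dim A.
Proof.
move=> sA bnd.
(* After [d] further extensions the length would exceed [N]; the start is the empty family with [d]
   equal to [N.+1]. *)
suff ext d M (v : 'I_M -> V) : lin_indep v -> (forall i, A (v i)) -> (N < M + d)%N ->
    finite_dim A.
  by apply: (ext N.+1 0%N (fun=> 0)) => [c _ []|[]|].
elim: d M v => [|d IHd] M v vi Av NM.
  by have := bnd _ _ vi Av; rewrite leqNgt -(addn0 M) NM.
have [Av'|/existsNP[x /not_implyP[Ax xv]]] := pselect (A `<=` lspan (range v)).
  exists M, v; split=> //; apply/seteqP; split=> //.
  by apply: lspan_min => // _ [i _ <-].
apply: IHd (lin_indep_extend vi xv) _ _; last by rewrite addSnnS.
by move=> i; case: unlift => [j|]/=.
Qed.

Lemma finite_dim_sub A B : subspace A -> A `<=` B -> finite_dim B -> finite_dim A.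
Proof.
move=> sA AB [N [b [_ bB]]]; apply: (@finite_dim_bounded _ N) => // M v vi Av.
by apply: (@lin_indep_leq _ b) vi _ => i; rewrite bB; exact: AB.
Qed.

End LinearSpan.

Lemma lspan_map (K : fieldType) (U V : lmodType K) (f : {linear V -> U}) (s : seq V) x :
  lspan [set` s] x -> lspan [set` map f s] (f x).
Proof.
move: x; apply: (lspan_min (subspace_preimage f (lspan_subspace _))) => y sy.
by apply: sub_lspan; rewrite /= map_f.
Qed.

(** * Orbits of the tuple and the polynomial action *)

Section OrbitSpan.
Variables (K : fieldType) (V : lmodType K) (n : nat) (T : 'I_n -> {linear V -> V}).
Implicit Types A B : set V.

(** For a commuting tuple, the submodule generated by [A]; its closure is [invariant_hull T A]. *)
Definition orbit_span A : set V :=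
  lspan [set y | exists (k : 'I_n -> nat) x, A x /\ y = tuple_pow T k x].

Lemma tuple_pow0 (k : 'I_n -> nat) x : (forall i, k i = 0%N) -> tuple_pow T k x = x.
Proof.
by move=> k0; rewrite /tuple_pow; elim/big_rec: _ => //= i f _ ->; rewrite k0.
Qed.

(** By commutativity [T i] moves past the factors of other indices until it meets its own power. *)
Lemma tuple_powS (k : 'I_n -> nat) i x : commuting_tuple T ->
  T i (tuple_pow T k x) = tuple_pow T (fun j => k j + (j == i))%N x.
Proof.
move=> Tc; rewrite /tuple_pow.
have Ti_iter j m y : T i (iter m (T j) y) = iter m (T j) (T i y).
  by elim: m => //= m IHm; rewrite Tc IHm.
(* The induction runs over any duplicate-free list containing [i]; once the factor of [i] is met,
   later exponents stay unchanged. *)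
have: i \in index_enum 'I_n by rewrite mem_index_enum.
have: uniq (index_enum 'I_n) by exact: index_enum_uniq.
elim: (index_enum _) => //= j s IHs /andP[js us].
rewrite !big_cons inE /= Ti_iter => /orP[/eqP ->|si].
  rewrite eqxx addn1 iterSr; congr (iter _ _ (T j _)).
  elim: s js {IHs us} => [|l s IHs]; first by rewrite !big_nil.
  rewrite inE negb_or => /andP[il /IHs]; rewrite !big_cons/= => ->.
  by rewrite [l == _]eq_sym (negPf il) addn0.
have /negPf -> : j != i by apply: contraNneq js => ->.
by rewrite addn0 IHs.
Qed.

Lemma tuple_pow_stable B (k : 'I_n -> nat) :
  (forall i x, B x -> B (T i x)) -> forall x, B x -> B (tuple_pow T k x).
Proof.
move=> BT; rewrite /tuple_pow; elim/big_rec: _ => //= i f _ IHf x Bx.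
by elim: (k i) => [|m IHm] /=; [exact: IHf|exact: BT].
Qed.

Lemma sub_orbit_span A : A `<=` orbit_span A.
Proof.
by move=> x Ax; apply: sub_lspan; exists (fun=> 0%N), x; rewrite tuple_pow0.
Qed.

Lemma orbit_span_subspace A : subspace (orbit_span A).
Proof. exact: lspan_subspace. Qed.

Lemma orbit_span_stable A : commuting_tuple T ->
  forall i x, orbit_span A x -> orbit_span A (T i x).
Proof.
move=> Tc i; apply: lspan_min; first exact/subspace_preimage/lspan_subspace.
move=> _ [k [x [Ax ->]]]; apply: sub_lspan.
by exists (fun j => k j + (j == i))%N, x; rewrite tuple_powS.
Qed.

Lemma orbit_span_min A B : subspace B -> (forall i x, B x -> B (T i x)) ->
  A `<=` B -> orbit_span A `<=` B.
Proof.
move=> sB BT AB; apply: lspan_min => // _ [k [x [Ax ->]]].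
by apply: tuple_pow_stable => //; exact: AB.
Qed.

(** Monomials outside the support have coefficient zero. Expanding several polynomials over one
    common list makes linearity in [p] a termwise check. *)
Lemma poly_act_widen (p : mpoly n K) (s : seq (multinom n)) x :
  uniq s -> {subset msupp p <= s} ->
  poly_act T p x = \sum_(m <- s) mcoeff m p *: tuple_pow T m x.
Proof.
move=> us ps; rewrite [RHS](bigID (mem (msupp p)))/= [X in _ + X]big1 ?addr0; last first.
  by move=> m /memN_msupp_eq0 ->; rewrite scale0r.
rewrite -big_filter; apply: perm_big; apply: uniq_perm.
- exact: msupp_uniq.
- exact: filter_uniq.
by move=> m; rewrite mem_filter /=; case: (boolP (m \in _)) => //= /ps ->.
Qed.

Lemma poly_actP (a : K) (p q : mpoly n K) x :
  poly_act T (a *: p + q) x = a *: poly_act T p x + poly_act T q x.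
Proof.
pose s := undup (msupp p ++ msupp q ++ msupp (a *: p + q)).
have us : uniq s := undup_uniq _.
rewrite !(poly_act_widen _ us); try by
  move=> m mp; rewrite mem_undup !mem_cat mp ?orbT.
rewrite scaler_sumr -big_split/=; apply: eq_bigr => m _.
by rewrite mcoeffD mcoeffZ scalerDl scalerA.
Qed.

Lemma poly_act0 x : poly_act T 0 x = 0.
Proof. by rewrite /poly_act msupp0 big_nil. Qed.

Definition monomial (k : 'I_n -> nat) : mpoly n K := mpolyX K (Multinom (mktuple k)).

Lemma poly_act_monomial (k : 'I_n -> nat) x :
  poly_act T (monomial k) x = tuple_pow T k x.
Proof.
rewrite /poly_act msuppX big_seq1 mcoeffX eqxx scale1r.
by congr (tuple_pow T _ x); apply/funext => i; rewrite /fun_of_multinom tnth_mktuple.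
Qed.

(** A tuple power is the action of a monomial; this links orbit spans to the polynomial coefficients
    of [generates_module]. *)
Lemma orbit_span_rangeP N (g : 'I_N -> V) x : orbit_span (range g) x <->
  exists p : 'I_N -> mpoly n K, x = \sum_(i < N) poly_act T (p i) (g i).
Proof.
split; last first.
  move=> [p ->]; apply: subspace_sum; first exact: orbit_span_subspace.
  move=> i _; apply: subspace_sum; first exact: orbit_span_subspace.
  move=> m _; apply: subspaceZ; first exact: orbit_span_subspace.
  by apply: sub_lspan; exists m, (g i); split=> //; exists i.
move: x; apply: (@lspan_min _ _ _
  [set x | exists p : 'I_N -> mpoly n K, x = \sum_(i < N) poly_act T (p i) (g i)]).
  split; first by exists (fun=> 0); rewrite big1// => i _; rewrite poly_act0.
  move=> a _ _ [p ->] [q ->]; exists (fun i => a *: p i + q i).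
  by rewrite scaler_sumr -big_split; apply: eq_bigr => i _; rewrite poly_actP.
move=> _ [k [_ [[i _ <-] ->]]].
exists (fun j => if j == i then monomial k else 0).
rewrite (bigD1 i)//= eqxx poly_act_monomial big1 ?addr0// => j /negPf ->.
by rewrite poly_act0.
Qed.

Lemma lspan_poly_act N (g : 'I_N -> V) :
  lspan [set y | exists (p : mpoly n K) i, y = poly_act T p (g i)] =
  orbit_span (range g).
Proof.
apply/seteqP; split.
  apply: lspan_min; first exact: orbit_span_subspace.
  move=> _ [p [i ->]]; apply: subspace_sum; first exact: orbit_span_subspace.
  move=> m _; apply: subspaceZ; first exact: orbit_span_subspace.
  by apply: sub_lspan; exists m, (g i); split=> //; exists i.
apply: lspan_mono => _ [k [_ [[i _ <-] ->]]].
by exists (monomial k), i; rewrite poly_act_monomial.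
Qed.

Lemma generates_moduleP (M : set V) N (g : 'I_N -> V) : generates_module T M g <->
  (forall i, M (g i)) /\ M `<=` orbit_span (range g).
Proof.
by split=> -[Mg MP]; split=> // x /MP /orbit_span_rangeP.
Qed.

End OrbitSpan.

(** * Cauchy-Schwarz and orthogonal projection on a finite span *)

Section InnerProduct.
Variables (C : numClosedFieldType) (V : lmodType C) (dot : {dot V for @Num.conj C}).

Lemma ortho_subspacer w : subspace [set z | dot w z = 0].
Proof.
split=> [|a x y /= wx wy]; rewrite /= ?linear0r//.
by rewrite linearDr linearZr_LR/= wx wy mulr0 addr0.
Qed.

Lemma ortho_subspacel z : subspace [set w | dot w z = 0].
Proof.
split=> [|a x y /= wx wy]; rewrite /= ?linear0l//.
by rewrite linearDl linearZl_LR/= wx wy mulr0 addr0.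
Qed.

(** Cauchy-Schwarz: [w] is the part of [u] orthogonal to [v], and Pythagoras leaves the nonnegative
    excess [dot w w]. *)
Lemma dot_sqr_leq u v : `|dot u v| ^+ 2 <= dot u u * dot v v.
Proof.
have [->|v0] := eqVneq v 0; first by rewrite !linear0r normr0 expr0n.
have vv : 0 < dot v v by rewrite dnorm_gt0.
pose a := dot u v / dot v v; pose w := u - a *: v.
have wv : dot w v = 0.
  by rewrite linearBl linearZl_LR/= divfK ?subrr// gt_eqF.
have -> : dot u u = dot w w + `|a| ^+ 2 * dot v v.
  rewrite -dnormZ -hnormDd ?subrK//.
  by rewrite linearZr_LR/= wv mulr0.
rewrite mulrDl -mulrA -expr2 -[X in `|a| ^+ 2 * X ^+ 2]gtr0_norm// -exprMn -normrM.
by rewrite divfK ?gt_eqF// lerDr mulr_ge0// ?dnorm_ge0// ltW.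
Qed.

(* Gram-Schmidt; for a finite family no completeness is needed. *)
Lemma finite_ortho_split (s : seq V) x : exists2 y, lspan [set` s] y &
  forall z, lspan [set` s] z -> dot (x - y) z = 0.
Proof.
elim: s x => [|e s IHs] x.
  exists 0; first exact: subspace0 (lspan_subspace _).
  by apply: lspan_min; first exact: ortho_subspacer.
have [y ys xy] := IHs x; have [f fs ef] := IHs e.
have ss : lspan [set` s] `<=` lspan [set` e :: s].
  by apply: lspan_mono => z /= zs; rewrite inE zs orbT.
have sub_span := lspan_subspace [set` e :: s].
(* [e - f] is the part of [e] orthogonal to the span of [s], and [a] is the coefficient of [x - y]
   along it. If [e - f] is zero, the value of the quotient does not matter. *)
pose a := dot (x - y) (e - f) / dot (e - f) (e - f).
exists (y + a *: (e - f)).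
  apply: subspaceD => //; first exact: ss.
  apply: subspaceZ => //; apply: subspaceB => //; last exact: ss.
  by apply: sub_lspan; rewrite /= inE eqxx.
have orth_s z : lspan [set` s] z -> dot (x - (y + a *: (e - f))) z = 0.
  by move=> zs; rewrite opprD addrA linearBl linearZl_LR/= xy// ef// mulr0 subr0.
apply: lspan_min; first exact: ortho_subspacer.
move=> z /=; rewrite inE => /orP[/eqP ->|zs]; last exact/orth_s/sub_lspan.
rewrite -[e in X in dot _ X](subrK f) linearDr /= (orth_s f)// addr0.
rewrite opprD addrA linearBl linearZl_LR/= /a.
have [->|ef0] := eqVneq (e - f) 0; first by rewrite !linear0r subr0.
by rewrite divfK ?subrr// dnorm_eq0.
Qed.

End InnerProduct.

(** * Orthogonality and bounded operators under closure *)

Section HilbertClosure.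
Variables (R : realType) (H : completeNormedModType R[i]).
Variables (dot : {dot H for Num.conj}) (dot_norm : induces_norm dot).

(** For z in D, Cauchy-Schwarz bounds |<w, y>| = |<w, y - z>| by |w| |y - z|, which can be made
    arbitrarily small. *)
Lemma ortho_closure (D : set H) w y :
  (forall z, D z -> dot w z = 0) -> closure D y -> dot w y = 0.
Proof.
move=> wD Dy; apply/eqP; rewrite -normr_eq0; apply: contrapT => /negP e0.
have {}e0 : 0 < `|dot w y| by rewrite lt_def e0 normr_ge0.
have w1 : 0 < `|w| + 1 by rewrite ltr_pwDr.
have [z [Dz]] := Dy _ (nbhsx_ballx y _ (divr_gt0 e0 w1)).
rewrite -ball_normE/= ltr_pdivlMr// => yz.
have : `|dot w y| <= `|w| * `|y - z|.
  rewrite -(@ler_pXn2r _ 2)// ?nnegrE ?mulr_ge0// exprMn -!dot_norm.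
  rewrite -[dot w y]subr0 -(wD z Dz) -linearBr; exact: dot_sqr_leq.
move=> wy; suff: `|dot w y| < `|dot w y| by rewrite ltxx.
apply: le_lt_trans wy (le_lt_trans _ yz).
by rewrite mulrC ler_wpM2l// lerDl.
Qed.

(** Such a [w] is orthogonal to the closure, hence to itself. *)
Lemma dense_ortho_eq0 (D : set H) w : closure D = [set: H] ->
  (forall z, D z -> dot w z = 0) -> w = 0.
Proof.
move=> dD wD; apply/eqP; rewrite -(dnorm_eq0 dot); apply/eqP.
by apply: ortho_closure wD _; rewrite dD.
Qed.

Lemma bounded_op_closure (f : {linear H -> H}) (D : set H) y :
  bounded_op f -> closure D y -> closure (f @` D) (f y).
Proof.
move=> [M fM] Dy B /nbhs_ballP[e /= e0 eB].
(* The constant in [bounded_op] may be negative, hence the absolute value; adding 1 makes the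
   divisor positive. *)
have M0 : 0 <= (`|M|%:C)%C :> R[i] by rewrite ler0c.
have M1 : 0 < (`|M|%:C)%C + 1 :> R[i] by rewrite ltr_pwDr.
have [z [Dz]] := Dy _ (nbhsx_ballx y _ (divr_gt0 e0 M1)).
rewrite -ball_normE/= ltr_pdivlMr// => yz.
exists (f z); split; first by exists z.
apply: eB; rewrite -ball_normE/= -linearB; apply: le_lt_trans (fM _) _.
apply: le_lt_trans yz; rewrite mulrC ler_wpM2l//.
by apply: (@le_trans _ _ (`|M|%:C)%C); rewrite ?lecR ?ler_norm// lerDl.
Qed.

End HilbertClosure.

(** * Wandering vectors and the bound on their dimension *)

Section Wandering.
Variables (R : realType) (H : completeNormedModType R[i]).
Variables (dot : {dot H for Num.conj}) (n : nat) (T : 'I_n -> {linear H -> H}).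
Local Notation W := (wandering T dot).

Lemma wanderingP w : W w <-> forall i x, dot w (T i x) = 0.
Proof.
split=> [Ww i x|wT _ [x ->]]; last first.
  by rewrite linear_sumr big1// => i _; exact: wT.
apply: Ww; exists (fun j => if j == i then x else 0).
by rewrite (bigD1 i)//= eqxx big1 ?addr0// => j /negPf ->; rewrite linear0.
Qed.

Lemma wandering_subspace : subspace W.
Proof.
split=> [|a w v Ww Wv]; first by move=> y _; exact: linear0l.
move=> y yT; apply: (ortho_subspacel dot y).2; [exact: Ww|exact: Wv].
Qed.

(** For nonzero k, T^k x lies in the range of some [T i], to which [w] is orthogonal; k = 0 leaves
    an element of [A]. *)
Lemma wandering_orbit_span (A : set H) w : commuting_tuple T -> W w ->
  (forall x, A x -> dot w x = 0) -> forall y, orbit_span T A y -> dot w y = 0.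
Proof.
move=> Tc /wanderingP wT wA; apply: lspan_min; first exact: ortho_subspacer.
move=> _ [k [x [Ax ->]]] /=.
have [k0|] := pselect (forall i, k i = 0%N); first by rewrite tuple_pow0// wA.
move=> /existsNP[i /eqP ki].
have -> : k = (fun j => (k j - (j == i)) + (j == i))%N.
  by apply/funext => j; rewrite subnK//; case: eqVneq => // ->; rewrite lt0n.
by rewrite -(tuple_powS (fun j => k j - (j == i))%N)// wT.
Qed.

(* If [M > l], some nonzero combination of the [v i] is orthogonal to all [a j],
   hence to the dense subspace they generate. *)
Lemma wandering_dim_leq l (a : 'I_l -> H) M (v : 'I_M -> H) :
  induces_norm dot -> commuting_tuple T ->
  closure (orbit_span T (range a)) = [set: H] ->
  lin_indep v -> (forall i, W (v i)) -> (M <= l)%N.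
Proof.
move=> dot_norm Tc ad vi Wv; rewrite leqNgt; apply/negP => lM.
have [u /eqP u0 ua] := wide_matrix_kernel (\matrix_(i, j) dot (v i) (a j)) lM.
apply: u0; apply/rowP => i; rewrite mxE; apply: (vi (fun i => u 0 i)) => {i}.
apply: (dense_ortho_eq0 dot_norm ad); apply: wandering_orbit_span => //.
  apply: (subspace_sum wandering_subspace) => i _.
  exact: (subspaceZ wandering_subspace).
move=> _ [j _ <-]; move/rowP/(_ j) : ua; rewrite !mxE => <-.
rewrite linear_sumlz; apply: eq_bigr => i _.
by rewrite linearZl_LR mxE.
Qed.

End Wandering.

(** * Graded components and homogeneous wandering vectors *)

Section Graded.
Variables (R : realType) (H : completeNormedModType R[i]).
Variables (dot : {dot H for Num.conj}) (dot_norm : induces_norm dot).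
Variables (Hk : nat -> set H) (Hk_sum : hilbert_direct_sum dot Hk).
Local Notation Htilde := (alg_sum Hk).

Lemma graded_subspace k : subspace (Hk k).
Proof. by have [] := Hk_sum. Qed.

Lemma alg_sum_dense : closure Htilde = [set: H].
Proof. by have [] := Hk_sum. Qed.

Lemma alg_sum_min (B : set H) :
  subspace B -> (forall k, Hk k `<=` B) -> Htilde `<=` B.
Proof.
move=> sB HB _ [m [v [Hv ->]]].
by apply: subspace_sum => // k _; apply: HB.
Qed.

Lemma graded_sub_alg_sum k : Hk k `<=` Htilde.
Proof.
move=> x Hx; exists k.+1, (fun j => if j == k then x else 0); split=> [j|].
  by case: eqP => [->//|_]; exact: subspace0 (graded_subspace j).
rewrite big_nat_recr//= eqxx big_nat big1 ?add0r// => j /andP[_ jk].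
by rewrite ltn_eqF.
Qed.

Lemma alg_sum_subspace : subspace Htilde.
Proof.
have -> : Htilde = lspan (\bigcup_k Hk k).
  apply/seteqP; split.
    apply: alg_sum_min; first exact: lspan_subspace.
    by move=> k x kx; apply: sub_lspan; exists k.
  move=> _ [m [c [v [Hv ->]]]].
  have {Hv}/choice[d Hv] i : exists k, Hk k (v i) by have [k _] := Hv i; exists k.
  pose u k := \sum_(i < m | d i == k) c i *: v i.
  (* The sum in [alg_sum] excludes its upper bound, hence the successor; every [d i] is then below
     it, so [inord] preserves degrees. *)
  exists (\max_(i < m) d i).+1, u; split=> [k|].
    apply: (subspace_sum (graded_subspace k)) => i /eqP <-.
    exact: (subspaceZ (graded_subspace _)).
  rewrite big_mkord (partition_big (fun i => inord (d i) : 'I_(\max_(i < m) d i).+1) xpredT)//=.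
  apply: eq_bigr => k _; apply: eq_bigl => i.
  by rewrite -val_eqE/= inordK// ltnS; exact: leq_bigmax.
exact: lspan_subspace.
Qed.

Variables (n : nat) (gamma : 'I_n -> nat) (gamma_gt0 : forall i, (0 < gamma i)%N).
Variables (T : 'I_n -> {linear H -> H}).
Hypotheses (T_bounded : forall i, bounded_op (T i)) (T_comm : commuting_tuple T).
Hypothesis T_deg : of_degree T Hk gamma.
Local Notation W := (wandering T dot).

(** [T i] maps the components not listed into degrees other than k, which are orthogonal to [w].
    Boundedness and the density of [Htilde] extend this to all of [T i H]. *)
Lemma graded_wandering k w : Hk k w ->
  (forall i j x, (j + gamma i = k)%N -> Hk j x -> dot w (T i x) = 0) -> W w.
Proof.
move=> Hw wT; have [_ _ orth _] := Hk_sum.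
apply/wanderingP => i x; apply: (@ortho_closure _ _ _ dot_norm (T i @` Htilde)).
  move=> _ [z Hz <-]; move: z Hz.
  apply: (alg_sum_min (subspace_preimage (T i) (ortho_subspacer dot w))) => j z Hz /=.
  have [ijk|/eqP] := eqVneq (j + gamma i)%N k; first exact: (wT i j).
  by move=> /nesym ijk; apply: orth ijk Hw _; exact: T_deg.
by apply: bounded_op_closure => //; rewrite alg_sum_dense.
Qed.

(** Spanning lists of the lower degrees belong to the induction because the projection in degree k
    is onto the span of a finite list. *)
Lemma graded_finite_generation : finite_dim W -> forall k,
  (exists s : seq H, [set` s] `<=` Hk k /\ Hk k `<=` lspan [set` s]) /\
  Hk k `<=` orbit_span T (\bigcup_j (W `&` Hk j)).
Proof.
move=> fW; elim/ltn_ind => k IHk.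
have sO := orbit_span_subspace T (\bigcup_j (W `&` Hk j)).
(* Positivity of [gamma i] makes the degree drop strictly. *)
have lt_sub i : (gamma i <= k)%N -> (k - gamma i < k)%N.
  by move=> ik; rewrite -[X in (_ < X)%N](subnK ik) -[X in (X < _)%N]addn0 ltn_add2l.
(* If [gamma i] exceeds k, no component is mapped to degree k by [T i], and the empty list is a
   dummy value. *)
have /choice[s sP] i : exists s : seq H, (gamma i <= k)%N ->
    [set` s] `<=` Hk (k - gamma i)%N /\ Hk (k - gamma i)%N `<=` lspan [set` s].
  have [ik|ki] := leqP (gamma i) k; last by exists [::].
  have [|[s sP] _] := IHk (k - gamma i)%N; last by exists s.
  exact: lt_sub.
pose t := [seq T i y | i <- [seq i <- enum 'I_n | (gamma i <= k)%N], y <- s i].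
have tP y : [set` t] y -> exists i x, [/\ (gamma i <= k)%N, Hk (k - gamma i)%N x & y = T i x].
  move=> /= /allpairsPdep[i [x []]]; rewrite mem_filter => /andP[ik _] xs ->.
  by exists i, x; split=> //; apply: (sP i ik).1.
have tH : [set` t] `<=` Hk k.
  by move=> _ /tP[i [x [ik Hx ->]]]; rewrite -(subnK ik); exact: T_deg.
have tO : [set` t] `<=` orbit_span T (\bigcup_j (W `&` Hk j)).
  move=> _ /tP[i [x [ik Hx ->]]]; apply: orbit_span_stable => //.
  exact: (IHk _ (lt_sub i ik)).2 Hx.
(* The residue of the projection on the span of [t] stays in [Hk k] and is orthogonal to every
   [T i z] of degree k, so it is wandering. *)
have split_Hk x : Hk k x -> exists2 y, lspan [set` t] y & (W `&` Hk k) (x - y).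
  move=> Hx; have [y ty xy] := finite_ortho_split dot t x; exists y => //.
  have Hxy : Hk k (x - y).
    apply: (subspaceB (graded_subspace k)) => //.
    exact: lspan_min (graded_subspace k) tH _ ty.
  split=> //; apply: (graded_wandering Hxy) => i j z ijk Hz; apply: xy.
  have ik : (gamma i <= k)%N by rewrite -ijk leq_addl.
  apply: (@lspan_mono _ _ [set` map (T i) (s i)]).
    move=> /= _ /mapP[u us ->]; apply/allpairsPdep; exists i, u.
    by rewrite mem_filter ik mem_enum.
  by apply: lspan_map; apply: (sP i ik).2; rewrite -ijk addnK.
(* A basis of the wandering vectors of degree k completes [t] to a spanning list of [Hk k]. *)
have [N [b bW]] : finite_dim (W `&` Hk k).
  apply: finite_dim_sub fW; last by move=> x [].
  exact: subspaceI (wandering_subspace _ _) (graded_subspace k).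
split.
  exists (t ++ codom b); split.
    move=> y /=; rewrite mem_cat => /orP[/tH//|/codomP[i ->]].
    exact: (is_basis_mem bW i).2.
  move=> x /split_Hk[y ty]; rewrite -bW.2 => xy.
  rewrite -(subrK y x); apply: subspaceD; first exact: lspan_subspace.
    apply: lspan_mono xy => _ [i _ <-] /=.
    by rewrite mem_cat codom_f orbT.
  by apply: lspan_mono ty => z /= zt; rewrite mem_cat zt.
move=> x /split_Hk[y ty xy]; rewrite -(subrK y x).
apply: (subspaceD sO); last exact: lspan_min sO tO _ ty.
by apply: sub_orbit_span; exists k.
Qed.

Lemma alg_sum_sub_orbit_span : finite_dim W ->
  Htilde `<=` orbit_span T (\bigcup_j (W `&` Hk j)).
Proof.
move=> fW; apply: alg_sum_min; first exact: orbit_span_subspace.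
by move=> k; exact: (graded_finite_generation fW k).2.
Qed.

Lemma wandering_sub_alg_sum : finite_dim W -> W `<=` Htilde.
Proof.
move=> fW w Ww; pose W' := lspan (\bigcup_j (W `&` Hk j)).
have W'W : W' `<=` W.
  by apply: lspan_min; [exact: wandering_subspace|move=> x [j _ []]].
(* Finite dimension of [W'] provides the projection [y] of [w] on it; the aim is [w = y]. *)
have [N [b [_ bW']]] := finite_dim_sub (lspan_subspace _) W'W fW.
have spanE : lspan [set` codom b] = W'.
  rewrite /W' -bW'; congr (lspan _); apply/seteqP; split=> [_ /= /codomP[i ->]|_ [i _ <-]].
    by exists i.
  exact: codom_f.
have [y] := finite_ortho_split dot (codom b) w; rewrite spanE => W'y wy.
suff wy0 : w - y = 0.
  have -> : w = y by apply/eqP; rewrite -subr_eq0 wy0.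
  move: y W'y {wy wy0}; apply: lspan_min; first exact: alg_sum_subspace.
  by move=> x [j _ [_]]; exact: graded_sub_alg_sum.
(* The residue is wandering and orthogonal to the homogeneous wandering vectors, hence to their
   orbit span, which contains the dense [Htilde]. *)
apply: (dense_ortho_eq0 dot_norm alg_sum_dense) => z /(alg_sum_sub_orbit_span fW).
apply: wandering_orbit_span => //.
  by apply: (subspaceB (wandering_subspace _ _)) => //; exact: W'W.
by move=> x Wx; apply/wy/sub_lspan.
Qed.

(** The homogeneous wandering vectors generate [Htilde] and lie in the span of [b]. *)
Lemma wandering_basis_generates N (b : 'I_N -> H) :
  is_basis W b -> generates_module T Htilde b.
Proof.
move=> bW; have fW : finite_dim W by exists N, b.
apply/generates_moduleP; split=> [i|].
  exact: wandering_sub_alg_sum fW _ (is_basis_mem bW i).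
apply: subset_trans (alg_sum_sub_orbit_span fW) _.
apply: orbit_span_min; first exact: orbit_span_subspace.
  by move=> i x; exact: orbit_span_stable.
move=> x [j _ [Wx _]]; move: Wx; rewrite -bW.2.
by apply: lspan_min; [exact: orbit_span_subspace|exact: sub_orbit_span].
Qed.

Lemma generates_module_dense N (g : 'I_N -> H) : generates_module T Htilde g ->
  closure (orbit_span T (range g)) = [set: H].
Proof.
move=> /generates_moduleP[_ gH]; apply/seteqP; split=> // x _.
by apply: (closureS gH); rewrite alg_sum_dense.
Qed.

End Graded.

(** * Equivalence of the finiteness conditions and minimality of the dimension *)

Theorem theorem2p3 (R : realType) (H : completeNormedModType R[i])
    (dot : {dot H for Num.conj}) (dot_norm : induces_norm dot)
    (Hk : nat -> set H) (Hk_sum : hilbert_direct_sum dot Hk)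
    (n : nat) (gamma : 'I_n -> nat) (gamma_gt0 : forall i, (0 < gamma i)%N)
    (T : 'I_n -> {linear H -> H})
    (T_bounded : forall i, bounded_op (T i))
    (T_comm : commuting_tuple T)
    (T_deg : of_degree T Hk gamma) :
  let W := wandering T dot in
  let Htilde := alg_sum Hk in
  [/\ (exists A : set H, finite_set A /\ invariant_hull T A = [set: H])
        <-> finite_dim W,
      finite_dim W <-> finitely_generated T Htilde
    & forall N, has_dim W N ->
        [/\ min_number_of_generators T Htilde N,
            is_cyclic T N,
            (forall N' (b : 'I_N' -> H), is_basis W b -> generates_module T Htilde b)
          & W `<=` Htilde]].
Proof.
move=> W Htilde.
(* Serves both (i) and (iii): either kind of generators spans a dense submodule, which bounds the
   independent families in [W]. *)
have dense_fin l (a : 'I_l -> H) :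
    closure (orbit_span T (range a)) = [set: H] -> finite_dim W.
  move=> ad; apply: finite_dim_bounded (wandering_subspace _ _) _ => M v.
  exact: wandering_dim_leq dot_norm T_comm ad.
have basis_gen N (b : 'I_N -> H) (bW : is_basis W b) :=
  wandering_basis_generates dot_norm Hk_sum gamma_gt0 T_bounded T_comm T_deg bW.
have gen_dense := generates_module_dense Hk_sum (T := T).
split.
- split=> [[A [/finite_seqP[s ->]] sH]|[N [b bW]]].
    apply: (dense_fin _ (tnth (in_tuple s))); rewrite -[RHS]sH.
    congr (closure (orbit_span T _)); apply/seteqP; split=> [_ [i _ <-]|x /= xs].
      exact: mem_tnth.
    by have /tnthP[i ->] : x \in in_tuple s by []; exists i.
  exists (range b); split; first exact: finite_image.
  exact: gen_dense (basis_gen _ _ bW).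
- split=> [[N [b bW]]|[N [g gH]]]; first by exists N, b; exact: basis_gen.
  exact: dense_fin (gen_dense _ _ gH).
move=> N [b bW].
(* Module generators and cyclic vectors both give a dense orbit span, so this bound settles both
   minimality claims. *)
have min_dense N' (a : 'I_N' -> H) :
    closure (orbit_span T (range a)) = [set: H] -> (N <= N')%N.
  move=> ad; apply: (wandering_dim_leq dot_norm T_comm ad bW.1).
  exact: is_basis_mem bW.
split.
- split; first by exists b; exact: basis_gen.
  by move=> N' [g /gen_dense]; exact: min_dense.
- split; first by exists b; rewrite /cyclic_vectors lspan_poly_act; exact/gen_dense/basis_gen.
  by move=> N' [g]; rewrite /cyclic_vectors lspan_poly_act; exact: min_dense.
- exact: basis_gen.
- by apply: (wandering_sub_alg_sum dot_norm Hk_sum gamma_gt0) => //; exists N, b.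
Qed.
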